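(* Let $\Omega\subset\mathbb{R}^N$ ($N\geq1$) be an open and bounded $BV$ extension domain. If $(u_n)_{n\ge1}\subset\mathcal{R}_\infty(\Omega)$, $u\in L^1(\Omega)$ and $u_n\to u$ in $L^1(\Omega)$, then $$(\varepsilon,\infty)\text{-}\mathrm{Var}\,u\le\liminf_{n}\,(\varepsilon,\infty)\text{-}\mathrm{Var}\,u_n\qquad\text{for each }\varepsilon>0.$$
   Context: Functions are real-valued and elements of $L^1(\Omega)$ are identified when they agree Lebesgue-almost everywhere; $\|\cdot\|_1$ and $\|\cdot\|_\infty$ are the $L^1(\Omega)$- and $L^\infty(\Omega)$-norms. When $N=1$, $\Omega$ is assumed to be an interval. Variation: for $u\in L^1(\Omega)$, $\mathrm{Var}\,u:=\sup\{\int_\Omega u\,\mathrm{div}\,\varphi\,dx \mid \varphi\in[C_c^1(\Omega)]^N,\ \|\varphi\|_\infty\le 1\}\in[0,\infty]$, and $BV(\Omega):=\{u\in L^1(\Omega)\mid \mathrm{Var}\,u<\infty\}$, a Banach space with norm $\|u\|_{BV}=\|u\|_1+\mathrm{Var}\,u$. $BV$ extension domain (Ambrosio–Fusco–Pallara, Definition 3.20): an open set $\Omega\subset\mathbb{R}^N$ with bounded boundary such that for every open set $A\supset\overline{\Omega}$ and every $m\ge1$ there is a linear continuous extension operator $T:[BV(\Omega)]^m\to[BV(\mathbb{R}^N)]^m$ (so $Tu=u$ a.e. in $\Omega$) with: $Tu=0$ a.e. in $\mathbb{R}^N\setminus A$ for all $u\in[BV(\Omega)]^m$; $|D(Tu)|(\partial\Omega)=0$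 for all $u\in[BV(\Omega)]^m$; and for every $q\in[1,\infty]$ the restriction of $T$ to $[W^{1,q}(\Omega)]^m$ is a linear continuous map into $[W^{1,q}(\mathbb{R}^N)]^m$. $(\varepsilon,\infty)$-variation: for $u\in L^1(\Omega)$ and $\varepsilon>0$, $(\varepsilon,\infty)\text{-}\mathrm{Var}\,u:=\inf\{\mathrm{Var}\,v\mid v\in BV(\Omega),\ \|u-v\|_\infty\le\varepsilon\}$, with the convention that the infimum over the empty set is $\infty$. $\infty$-regulated functions: $\mathcal{R}_\infty(\Omega):=\{u\in L^1(\Omega)\mid (\varepsilon,\infty)\text{-}\mathrm{Var}\,u<\infty\text{ for every }\varepsilon>0\}$. *)

(* Defs.v *)
From HB Require Import structures.
From mathcomp Require Import all_boot all_order all_algebra.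
From mathcomp Require Import all_classical all_reals all_analysis.
From mathcomp Require Import measurable_realfun.

Set Implicit Arguments.
Unset Strict Implicit.
Unset Printing Implicit Defensive.

Import Order.TTheory GRing.Theory Num.Theory.
Import numFieldNormedType.Exports.

Local Open Scope classical_set_scope.
Local Open Scope ring_scope.

(* R^N is 'rV[R]_N, with its library topology.  It gets the sigma-algebra
   generated by the coordinate maps, which is the Borel one: see
   measurable_open_rV.  L^p classes are handled through Borel representatives,
   which costs nothing because every Lebesgue-measurable function agrees almost
   everywhere with a Borel one. *)
Definition rV_display : measure_display. Proof. exact. Qed.

Section measurable_rV.
Variables (R : realType) (n : nat).

Definition rV_coord (i : 'I_n) (x : 'rV[R]_n) : R := x ord0 i.

Let rV_set0 : g_sigma_preimage rV_coord set0.
Proof. exact: sigma_algebra0. Qed.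

Let rV_setC A : g_sigma_preimage rV_coord A -> g_sigma_preimage rV_coord (~` A).
Proof. exact: sigma_algebraC. Qed.

Let rV_bigcup (F : (set 'rV[R]_n)^nat) :
  (forall i, g_sigma_preimage rV_coord (F i)) ->
  g_sigma_preimage rV_coord (\bigcup_i (F i)).
Proof. exact: sigma_algebra_bigcup. Qed.

HB.instance Definition _ := @isMeasurable.Build rV_display
  'rV[R]_n (g_sigma_preimage rV_coord) rV_set0 rV_setC rV_bigcup.

Lemma measurable_rV_coord (i : 'I_n) :
  measurable_fun [set: 'rV[R]_n] (fun x : 'rV[R]_n => x ord0 i).
Proof.
move=> _ Y mY; rewrite setTI; apply: sub_sigma_algebra => /=.
rewrite -bigcup_seq/=; exists i => /=; first by rewrite mem_index_enum.
by exists Y => //; rewrite setTI.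
Qed.

Lemma measurable_fun_rV d (T : measurableType d) (f : T -> 'rV[R]_n) :
  (forall i, measurable_fun [set: T] (fun x => f x ord0 i)) ->
  measurable_fun [set: T] f.
Proof.
move=> mf _ A mA; rewrite setTI.
suff: g_sigma_preimage rV_coord `<=` [set B | measurable (f @^-1` B)] by exact.
apply: smallest_sub.
  split => /=.
  - by rewrite preimage_set0.
  - by move=> B mB; rewrite setTD preimage_setC; exact: measurableC.
  - by move=> F mF; rewrite preimage_bigcup; exact: bigcup_measurable.
rewrite -bigcup_seq/=; apply: bigcup_sub => i _ _ [B mB <-] /=.
by rewrite setTI -comp_preimage -[X in measurable X]setTI; exact: mf.
Qed.

Lemma measurable_open_rV (U : set 'rV[R]_n) : open U -> measurable U.
Proof.
move=> oU.
pose box (qk : 'rV[rat]_n * nat) : set 'rV[R]_n :=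
  \bigcap_(i in [set: 'I_n])
    [set x : 'rV[R]_n | `|x ord0 i - ratr (qk.1 ord0 i)| < qk.2.+1%:R^-1].
have mbox qk : measurable (box qk).
  apply: fin_bigcap_measurable => // i _.
  have /(_ measurableT) := @measurable_rV_coord i.
  move=> /(_ (ball (ratr (qk.1 ord0 i) : R) qk.2.+1%:R^-1)) /=.
  rewrite setTI => H; rewrite (_ : [set x | _] =
    (fun x : 'rV[R]_n => x ord0 i) @^-1` ball (ratr (qk.1 ord0 i) : R) qk.2.+1%:R^-1).
    by apply: H; exact: measurable_ball.
  by apply/seteqP; split => x /=; rewrite /ball/= distrC.
rewrite (_ : U = \bigcup_(qk in [set qk | box qk `<=` U]) box qk); last first.
  apply/seteqP; split => [x Ux|x [qk /=]]; last exact.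
  have /nbhs_ballP[e /= e0 xeU] : nbhs x U by exact: open_nbhs_nbhs.
  have [k ke] : exists k : nat, k.+1%:R^-1 < e / 2.
    by have /ltr_add_invr[k] : 0 < e / 2 by [rewrite divr_gt0|];
      rewrite add0r; exists k.
  have /choice[q qx] : forall i, exists q : rat, `|x ord0 i - ratr q| < k.+1%:R^-1.
    move=> i; have /rat_in_itvoo[q] : x ord0 i - k.+1%:R^-1 < x ord0 i + k.+1%:R^-1 :> R.
      by rewrite ltrBlDr -addrA ltrDl addr_gt0 ?invr_gt0.
    by rewrite in_itv/= => qi; exists q; rewrite distrC ltr_distl.
  exists (\row_i q i, k) => /=; last by move=> i _ /=; rewrite mxE.
  move=> y yq; apply: xeU; split => // i j; rewrite (ord1 i).
  have := yq j Logic.I; rewrite /= mxE distrC => yj.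
  rewrite /ball/= (le_lt_trans (ler_distD (ratr (q j)) _ _))//.
  by rewrite (splitr e) ltrD// (lt_trans _ ke).
rewrite bigcup_mkcond; apply: countable_bigcupT_measurable => [|qk].
  exact: countableP.
by case: ifP.
Qed.

End measurable_rV.

(* Lebesgue measure on R^(n+1) as the image of the product of the Lebesgue
   measures on R and R^n. *)
Section lebesgue_rV_step.
Variables (R : realType) (n : nat).

Definition rV_cons (p : R * 'rV[R]_n) : 'rV[R]_n.+1 :=
  \row_i oapp (fun j => p.2 ord0 j) p.1 (unlift ord0 i).

Definition rV_uncons (x : 'rV[R]_n.+1) : R * 'rV[R]_n :=
  (x ord0 ord0, \row_j x ord0 (lift ord0 j)).

Lemma rV_consK : cancel rV_cons rV_uncons.
Proof.
move=> [x v]; rewrite /rV_uncons /rV_cons mxE unlift_none /=; congr pair.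
by apply/rowP => j; rewrite !mxE liftK.
Qed.

Lemma measurable_rV_cons : measurable_fun [set: R * 'rV[R]_n] rV_cons.
Proof.
apply: measurable_fun_rV => i; rewrite /rV_cons.
under eq_fun do rewrite mxE.
case: unliftP => [j _|_] /=; last exact: measurable_fst.
exact: (measurableT_comp (measurable_rV_coord j) measurable_snd).
Qed.

Lemma measurable_rV_uncons : measurable_fun [set: 'rV[R]_n.+1] rV_uncons.
Proof.
apply: measurable_fun_pair; first exact: measurable_rV_coord.
apply: measurable_fun_rV => i.
by under eq_fun do rewrite mxE; exact: measurable_rV_coord.
Qed.

Variable m : {sigma_finite_measure set 'rV[R]_n -> \bar R}.

Definition lebesgue_rV_step : set 'rV[R]_n.+1 -> \bar R :=
  pushforward (@lebesgue_measure R \x m)%E rV_cons.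

Let mcons := measurable_rV_cons.

Let lebesgue_rV_step0 : lebesgue_rV_step set0 = 0%E.
Proof. exact: measure0. Qed.

Let lebesgue_rV_step_ge0 A : (0 <= lebesgue_rV_step A)%E.
Proof. exact: measure_ge0. Qed.

Let lebesgue_rV_step_sigma_additive : semi_sigma_additive lebesgue_rV_step.
Proof. exact: measure_semi_sigma_additive. Qed.

HB.instance Definition _ := isMeasure.Build _ _ _ lebesgue_rV_step
  lebesgue_rV_step0 lebesgue_rV_step_ge0 lebesgue_rV_step_sigma_additive.

Let lebesgue_rV_step_sigma_finite : sigma_finite setT lebesgue_rV_step.
Proof.
have /sigma_finiteP[F [FT ndF Foo]] := sigma_finiteT (@lebesgue_measure R).
have /sigma_finiteP[G [GT ndG Goo]] := sigma_finiteT m.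
exists (fun k => rV_uncons @^-1` (F k `*` G k)).
  rewrite -preimage_bigcup (_ : \bigcup_k _ = setT) ?preimage_setT//.
  rewrite -subTset => -[x v] _.
  have [i _ Fx] : (\bigcup_i F i) x by rewrite -FT.
  have [j _ Gv] : (\bigcup_i G i) v by rewrite -GT.
  exists (maxn i j) => //; split => /=.
    by move: x Fx; exact/subsetPset/ndF/leq_maxl.
  by move: v Gv; exact/subsetPset/ndG/leq_maxr.
move=> k; have [mF Fk] := Foo k; have [mG Gk] := Goo k; split.
  rewrite -[X in measurable X]setTI; apply: measurable_rV_uncons => //.
  exact: measurableX.
rewrite /lebesgue_rV_step /pushforward -comp_preimage.
rewrite (_ : _ \o _ = id); last by apply/funext => x /=; rewrite rV_consK.
by rewrite preimage_id product_measure1E// lte_mul_pinfty// ge0_fin_numE.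
Qed.

HB.instance Definition _ := Measure_isSigmaFinite.Build _ _ _
  lebesgue_rV_step lebesgue_rV_step_sigma_finite.

End lebesgue_rV_step.

Fixpoint leb {R : realType} (n : nat) :
    {sigma_finite_measure set 'rV[R]_n -> \bar R} :=
  match n with
  | 0%N => \d_(0 : 'rV[R]_0)
  | n'.+1 => lebesgue_rV_step (leb n')
  end.

Section function_spaces.
Context {R : realType} {N : nat}.
Local Notation V := 'rV[R]_N.
Implicit Types (D A : set V) (u v : V -> R) (m : nat).

Definition partial (i : 'I_N) u : V -> R := 'D_(delta_mx ord0 i) u.

Definition C1 u : Prop :=
  continuous u /\
  forall i, (forall x, derivable u x (delta_mx ord0 i)) /\
            continuous (partial i u).

(* Elements of C_c^1(D) are extended by 0 to the whole space. *)
Definition C1c D u : Prop :=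
  let supp := closure [set x | u x != 0] in
  [/\ C1 u, compact supp & supp `<=` D].

(* The components of a vector field are given as a family of functions. *)
Definition divergence (phi : 'I_N -> V -> R) (x : V) : R :=
  \sum_(i < N) partial i (phi i) x.

(* Norm of L^p(D): functions are only looked at on D. *)
Definition Lpnorm D (p : \bar R) u : \bar R :=
  Lnorm (leb N) p ((EFin \o u) \_ D).

Definition inLp D (p : \bar R) u : Prop :=
  measurable_fun D u /\ (Lpnorm D p u < +oo)%E.

Definition Var D u : \bar R :=
  ereal_sup [set (\int[leb N]_(x in D) (u x * divergence phi x)%:E)%E | phi in
    [set phi : 'I_N -> V -> R | (forall i, C1c D (phi i)) /\
      (Lpnorm D +oo%E (fun x => Num.sqrt (\sum_(i < N) phi i x ^+ 2)) <= 1)%E]].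

Definition inBV D u : Prop := inLp D 1%E u /\ (Var D u < +oo)%E.

Definition BVnorm D u : \bar R := (Lpnorm D 1%E u + Var D u)%E.

Definition eps_inf_Var D (eps : R) u : \bar R :=
  ereal_inf [set Var D v | v in
    [set v | inBV D v /\ (Lpnorm D +oo%E (u \- v)%R <= eps%:E)%E]].

Definition inf_regulated D u : Prop :=
  inLp D 1%E u /\ forall eps : R, 0 < eps -> (eps_inf_Var D eps u < +oo)%E.

Definition locally_L1 D u : Prop :=
  forall K : set V, compact K -> K `<=` D ->
    (leb N).-integrable K (EFin \o u).

Definition is_weak_gradient D u (g : 'I_N -> V -> R) : Prop :=
  locally_L1 D u /\
  forall i, locally_L1 D (g i) /\
    forall psi, C1c D psi ->
      (\int[leb N]_(x in D) (u x * partial i psi x)%:E =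
       - \int[leb N]_(x in D) (g i x * psi x)%:E)%E.

(* A weak gradient on an open set is unique up to null sets. *)
Definition weak_gradient D u : 'I_N -> V -> R :=
  xget (fun=> cst 0) (is_weak_gradient D u).

Definition inW1 D (q : \bar R) u : Prop :=
  [/\ inLp D q u, exists g, is_weak_gradient D u g
    & forall i, inLp D q (weak_gradient D u i)].

Definition W1norm D (q : \bar R) u : \bar R :=
  (Lpnorm D q u + \sum_(i < N) Lpnorm D q (weak_gradient D u i))%E.

(* Total variation in D of a family of m functions, with the Euclidean
   (Frobenius) norm on m x N matrices. *)
Definition Varm m D (u : 'I_m -> V -> R) : \bar R :=
  ereal_sup [set (\int[leb N]_(x in D)
                    (\sum_(a < m) u a x * divergence (phi a) x)%:E)%E | phi in
    [set phi : 'I_m -> 'I_N -> V -> R | (forall a i, C1c D (phi a i)) /\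
      (Lpnorm D +oo%E (fun x =>
         Num.sqrt (\sum_(a < m) \sum_(i < N) phi a i x ^+ 2)) <= 1)%E]].

(* The variation measure |Du| on R^N: its value on an open set A is the total
   variation of u in A, and it is extended to all sets by outer regularity. *)
Definition variation_measure m (u : 'I_m -> V -> R) (B : set V) : \bar R :=
  ereal_inf [set Varm A u | A in [set A : set V | open A /\ B `<=` A]].

(* Almost-everywhere-defined operators act on representatives: compatibility
   with a.e. equality, and linearity up to null sets, are imposed explicitly.
   The norm on an m-fold product is the sum of the norms of the components.
   In the last clause u also ranges over [BV(D)]^m, the domain of T; when D is
   bounded, W^{1,q}(D) is contained in BV(D) and this is no restriction. *)
Record BV_extension_operator D A m
    (T : ('I_m -> V -> R) -> ('I_m -> V -> R)) : Prop := {
  BVext_compat : forall u v : 'I_m -> V -> R,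
    (forall a, inBV D (u a)) -> (forall a, inBV D (v a)) ->
    (forall a, {ae leb N, forall x, D x -> u a x = v a x}) ->
    forall a, {ae leb N, forall x, T u a x = T v a x} ;
  BVext_BV : forall u : 'I_m -> V -> R, (forall a, inBV D (u a)) ->
    forall a, inBV setT (T u a) ;
  BVext_linear : forall (c : R) (u v : 'I_m -> V -> R),
    (forall a, inBV D (u a)) -> (forall a, inBV D (v a)) ->
    forall a, {ae leb N, forall x,
      T (fun b y => c * u b y + v b y) a x = c * T u a x + T v a x} ;
  BVext_continuous : exists C : R,
    forall u : 'I_m -> V -> R, (forall a, inBV D (u a)) ->
    (\sum_(a < m) BVnorm setT (T u a) <=
       C%:E * \sum_(a < m) BVnorm D (u a))%E ;
  BVext_extends : forall u : 'I_m -> V -> R, (forall a, inBV D (u a)) ->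
    forall a, {ae leb N, forall x, D x -> T u a x = u a x} ;
  BVext_support : forall u : 'I_m -> V -> R, (forall a, inBV D (u a)) ->
    forall a, {ae leb N, forall x, ~ A x -> T u a x = 0} ;
  BVext_boundary : forall u : 'I_m -> V -> R, (forall a, inBV D (u a)) ->
    variation_measure (T u) (closure D `\` interior D) = 0%E ;
  BVext_Sobolev : forall q : \bar R, (1 <= q)%E ->
    (forall u : 'I_m -> V -> R,
       (forall a, inBV D (u a)) -> (forall a, inW1 D q (u a)) ->
       forall a, inW1 setT q (T u a)) /\
    exists C : R, forall u : 'I_m -> V -> R,
      (forall a, inBV D (u a)) -> (forall a, inW1 D q (u a)) ->
      (\sum_(a < m) W1norm setT q (T u a) <=
         C%:E * \sum_(a < m) W1norm D q (u a))%E }.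

Definition BV_extension_domain D : Prop :=
  [/\ open D, bounded_set (closure D `\` interior D)
    & forall A, open A -> closure D `<=` A -> forall m, (1 <= m)%N ->
        exists T : ('I_m -> V -> R) -> ('I_m -> V -> R),
          BV_extension_operator D A T].

End function_spaces.

(* Main.v *)
Require Import Defs.
From mathcomp Require Import all_boot all_order all_algebra.
From mathcomp Require Import all_classical all_reals all_analysis.
From mathcomp Require Import measurable_realfun ess_sup_inf ring lra.

Import Order.TTheory GRing.Theory Num.Theory.
Import numFieldNormedType.Exports.

Local Open Scope classical_set_scope.
Local Open Scope ring_scope.

(* Compactness of BV is replaced by convexity.  Let L exceed the lower limit.
   There are arbitrarily late indices k and some v with |v - u_k| <= eps and
   Var v <= L.  For every n, the functions w with |w| <= eps for which some u'
   satisfies |u' - u|_1 <= 1/n and Var (u' + w) <= L + 1/n therefore form a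
   nonempty convex set K_n, and K_n decreases with n.  By the parallelogram
   identity, near-minimisers of the L^2 norm on the K_n are Cauchy in L^2, so
   some sequence w_n in K_n converges almost everywhere to a function w with
   |w| <= eps.  As u'_n + w_n -> u + w in L^1 and the divergences of test
   fields are bounded, Var (u + w) <= L. *)

(** * Integrability on a set of finite measure and almost everywhere convergence *)

Lemma integrable_le_normr {d} {T : measurableType d} {R : realType}
    (mu : {measure set T -> \bar R}) (D : set T) (f : T -> R) (C : R) :
  measurable D -> (mu D < +oo)%E -> measurable_fun D f ->
  (forall x, D x -> `|f x| <= C) -> mu.-integrable D (EFin \o f).
Proof.
move=> mD Doo mf fC; apply: measurable_bounded_integrable => //.
exists C; split; first exact: num_real.
move=> M CM x /= Dx. rewrite (le_trans _ (ltW CM))//. exact: fC.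
Qed.

(** The bounds [c / 2 ^ n.+1] sum to [c], so the series of the increments [|w_ n.+1 x - w_ n x|] has
    a finite integral and is finite for almost every [x]. At such a point the telescoping series of
    differences converges absolutely. *)
Lemma ae_cvg_of_summable_L1 {d} {T : measurableType d} {R : realType}
    (mu : {measure set T -> \bar R}) (D : set T) (w_ : nat -> T -> R) (c : R) :
  measurable D -> (forall n, measurable_fun D (w_ n)) -> 0 <= c ->
  (forall n, (\int[mu]_(x in D) `|w_ n.+1 x - w_ n x|%:E <=
              (c / (2 ^ n.+1)%:R)%:E)%E) ->
  {ae mu, forall x, D x -> cvgn (fun n => w_ n x)}.
Proof.
move=> mD mw c0 h.
pose a n x : \bar R := `|w_ n.+1 x - w_ n x|%:E.
have ma n : measurable_fun D (a n).
  apply/measurable_EFinP; apply: measurableT_comp => //.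
  exact: measurable_funB.
have a0 n x : D x -> (0 <= a n x)%E by rewrite lee_fin.
have ia : mu.-integrable D (fun x => \sum_(n <oo) a n x)%E.
  apply/integrableP; split.
    by apply: ge0_emeasurable_sum => // n x Dx _; exact: a0.
  under eq_integral => x /set_mem Dx.
    rewrite gee0_abs; last by apply: nneseries_ge0 => n _ _; exact: a0.
    over.
  rewrite integral_nneseries//.
  apply: (@le_lt_trans _ _ c%:E); last exact: ltry.
  apply: le_trans (epsilon_trick0 xpredT c0).
  apply: lee_nneseries => [n _ _|n _]; first by apply: integral_ge0 => x; exact: a0.
  exact: h.
have := integrable_ae mD ia.
apply: filterS => x /[apply] fx.
rewrite (_ : (fun n => w_ n x) =
    (fun n => w_ 0%N x + series (fun k => w_ k.+1 x - w_ k x) n)); last first.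
  apply/funext => n; rewrite /series/= telescope_sumr//.
  by rewrite addrC subrK.
apply: is_cvgD; first exact: is_cvg_cst.
apply: normed_cvg.
have [M aM] : exists M, forall n, [normed series (fun k => w_ k.+1 x - w_ k x)] n <= M.
  exists (fine (\sum_(n <oo) a n x)%E) => n.
  rewrite -lee_fin fineK// /series/= -sumEFin.
  apply: (@nneseries_lim_ge _ (fun k => a k x) xpredT 0 n) => k _ _; exact: normr_ge0.
apply: nondecreasing_is_cvgn; first by apply: nondecreasing_series => *; exact: normr_ge0.
by exists M => _ [n _ <-].
Qed.

Lemma integrable_sqr {d} {T : measurableType d} {R : realType}
    (mu : {measure set T -> \bar R}) (D : set T) (f : T -> R) (C : R) :
  measurable D -> (mu D < +oo)%E -> measurable_fun D f ->
  (forall x, D x -> `|f x| <= C) ->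
  mu.-integrable D (EFin \o (fun x => f x ^+ 2)).
Proof.
move=> mD Doo mf fC; apply: (integrable_le_normr _ _ _ (C ^+ 2)) => //.
  exact: measurable_funX.
move=> x Dx; have fxC := fC x Dx.
by rewrite normrX lerXn2r ?nnegrE// (le_trans _ fxC).
Qed.

Lemma integrable_scale {d} {T : measurableType d} {R : realType}
    (mu : {measure set T -> \bar R}) (D : set T) (c : R) (f : T -> R) :
  measurable D -> mu.-integrable D (EFin \o f) ->
  mu.-integrable D (EFin \o (fun x => c * f x)).
Proof.
move=> mD /(integrableZl mD c); apply: eq_integrable => // x _ /=.
Qed.

Lemma integrable_add {d} {T : measurableType d} {R : realType}
    (mu : {measure set T -> \bar R}) (D : set T) (f g : T -> R) :
  measurable D -> mu.-integrable D (EFin \o f) ->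
  mu.-integrable D (EFin \o g) ->
  mu.-integrable D (EFin \o (fun x => f x + g x)).
Proof. by move=> mD /(integrableD mD) /[apply]; exact: eq_integrable. Qed.

(** * Near-minimisers of the L^2 norm over decreasing midpoint-convex sets *)

(** The infima [m n] of the squared norm over [K n] increase with [n] and are bounded, with supremum
    [S]. Far enough along, a near-minimiser has squared norm below [S + e_ n], while every member of
    its set has squared norm above [S - e_ n]. The parallelogram identity then keeps consecutive
    choices close. *)
Lemma exists_fast_cauchy_L2 {d} {T : measurableType d} {R : realType}
    (mu : {measure set T -> \bar R}) (D : set T) (eps : R)
    (K : nat -> set (T -> R)) (e_ : nat -> R) :
  measurable D -> (mu D < +oo)%E ->
  (forall m n, (m <= n)%N -> K n `<=` K m) ->
  (forall n, K n !=set0) ->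
  (forall n f, K n f -> measurable_fun D f) ->
  (forall n f, K n f -> forall x, D x -> `|f x| <= eps) ->
  (forall n f g, K n f -> K n g -> K n (fun x => (f x + g x) / 2)) ->
  (forall n, 0 < e_ n) -> (forall n, e_ n.+1 <= e_ n) ->
  exists w_ : nat -> T -> R, forall n, K n (w_ n) /\
    \int[mu]_(x in D) (w_ n.+1 x - w_ n x) ^+ 2 <= 8 * e_ n.
Proof.
move=> mD Doo Kdecr K0 mK bK mid e0 edecr.
pose I f : R := \int[mu]_(x in D) f x ^+ 2.
have iK n f : K n f -> mu.-integrable D (EFin \o (fun x => f x ^+ 2)).
  by move=> Kf; apply: (integrable_sqr mu D f eps) => //; [exact: mK Kf|exact: bK Kf].
have I0 f : 0 <= I f by apply: Rintegral_ge0 => x _; exact: sqr_ge0.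
have Ibnd n f : K n f -> I f <= eps ^+ 2 * fine (mu D).
  move=> Kf; rewrite -Rintegral_cst//; apply: le_Rintegral => //.
  - exact: iK Kf.
  - apply: (integrable_le_normr _ _ _ `|eps ^+ 2|) => //.
  - move=> x Dx; rewrite -real_normK ?num_real// lerXn2r ?nnegrE//; last exact: bK Kf _ _.
    by rewrite (le_trans _ (bK _ _ Kf x Dx)).
pose m n := inf (I @` K n).
have hasinf n : has_inf (I @` K n).
  split; first by have [f Kf] := K0 n; exists (I f), f.
  by exists 0 => _ [f _ <-].
have mle n f : K n f -> m n <= I f.
  by move=> Kf; apply: ge_inf; [exact: (hasinf n).2|exists f].
have minc k n : (k <= n)%N -> m k <= m n.
  move=> kn; apply: lb_le_inf; first exact: (hasinf n).1.
  by move=> _ [f Kf <-]; apply: mle; exact: Kdecr Kf.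
have hassup : has_sup (range m).
  split; first by exists (m 0%N), 0%N.
  exists (eps ^+ 2 * fine (mu D)) => _ [n _ <-].
  by have [f Kf] := K0 n; rewrite (le_trans (mle _ _ Kf))// (Ibnd _ _ Kf).
pose S := sup (range m).
have mS n : m n <= S by apply: ub_le_sup; [exact: hassup.2|exists n].
have key n : exists kf : nat * (T -> R), [/\ (n <= kf.1)%N, K kf.1 kf.2,
    I kf.2 < S + e_ n & forall f, K kf.1 f -> S - e_ n < I f].
  (* The infimum over [K k] exceeds [S - e_ n]. Moving on to the index [maxn k n] preserves this and
     also puts the near-minimiser in [K n]. *)
  have [_ [k _ <-] Sk] := sup_adherent (e0 n) hassup.
  have kS : S - e_ n < m (maxn k n) by rewrite (lt_le_trans Sk)// minc// leq_maxl.
  have [_ [f Kf <-] fm] := inf_adherent (e0 n) (hasinf (maxn k n)).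
  exists (maxn k n, f); split => //=; first by rewrite leq_maxr.
    by rewrite (lt_le_trans fm)// lerD2r mS.
  by move=> g Kg; rewrite (lt_le_trans kS)// mle.
have [F HF] := choice key.
exists (fun n => (F n).2) => n.
have [n1 n2 n3 n4] := HF n.
split; first exact: Kdecr n2.
have [p1 p2 p3 p4] := HF n.+1.
set f := (F n).2 in n2 n3 *; set g := (F n.+1).2 in p2 p3 *.
have midI : S - e_ n < I (fun x => (f x + g x) / 2).
  (* The set with the smaller index contains the other one, hence also the midpoint, and the lower
     bound attached to that index applies. *)
  have [le|/ltnW le] := leqP (F n).1 (F n.+1).1.
    by apply: n4; apply: mid => //; exact: Kdecr p2.
  rewrite (@le_lt_trans _ _ (S - e_ n.+1))//; first by rewrite lerB.
  by apply: p4; apply: mid => //; exact: Kdecr n2.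
have if2 := iK _ _ n2; have ig2 := iK _ _ p2.
have im2 : mu.-integrable D (EFin \o (fun x => ((f x + g x) / 2) ^+ 2)).
  apply: (integrable_sqr mu D (fun x => (f x + g x) / 2) eps) => //.
    by apply: measurable_funM => //; apply: measurable_funD; [exact: mK n2|exact: mK p2].
  move=> x Dx; rewrite normrM normfV [X in _ / X]ger0_norm//.
  have := bK _ _ n2 x Dx; have := bK _ _ p2 x Dx.
  have := ler_normD (f x) (g x); lra.
(* Parallelogram identity. Its right side is at most [2 (S + e_ n) + 2 (S + e_ n.+1) - 4 (S - e_
   n)], which is at most [8 e_ n]. *)
have -> : \int[mu]_(x in D) (g x - f x) ^+ 2 =
    2 * I f + 2 * I g - 4 * I (fun x => (f x + g x) / 2).
  rewrite /I -!RintegralZl// -RintegralD//; [|exact: integrable_scale|exact: integrable_scale].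
  rewrite -RintegralB//; [|by apply: integrable_add => //; exact: integrable_scale|exact: integrable_scale].
  by apply: eq_Rintegral => x _ /=; field.
have := edecr n; lra.
Qed.

(** With tolerances [4^-n] the L^2 increments decay like [2^-n]. On a set of finite measure the L^1
    increments do so too, and are therefore summable. *)
Lemma exists_ae_limit {d} {T : measurableType d} {R : realType}
    (mu : {measure set T -> \bar R}) (D : set T) (eps : R)
    (K : nat -> set (T -> R)) :
  measurable D -> (mu D < +oo)%E ->
  (forall m n, (m <= n)%N -> K n `<=` K m) ->
  (forall n, K n !=set0) ->
  (forall n f, K n f -> measurable_fun D f) ->
  (forall n f, K n f -> forall x, D x -> `|f x| <= eps) ->
  (forall n f g, K n f -> K n g -> K n (fun x => (f x + g x) / 2)) ->
  exists (w_ : nat -> T -> R) (w : T -> R), [/\ forall n, K n (w_ n),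
    measurable_fun D w & {ae mu, forall x, D x -> w_ ^~ x @ \oo --> w x}].
Proof.
move=> mD Doo Kdecr K0 mK bK mid.
pose e_ n : R := (2^-1 ^+ n) ^+ 2.
have e0 n : 0 < e_ n by rewrite /e_ exprn_gt0// exprn_gt0.
have edecr n : e_ n.+1 <= e_ n.
  rewrite /e_ lerXn2r ?nnegrE ?exprn_ge0// exprS.
  by rewrite ler_piMl ?exprn_ge0// invf_le1// ler1n.
have [w_ hw] := exists_fast_cauchy_L2 mu D eps K e_ mD Doo Kdecr K0 mK bK mid e0 edecr.
have mw n : measurable_fun D (w_ n) by apply: mK; exact: (hw n).1.
pose M := fine (mu D).
have M0 : 0 <= M by rewrite fine_ge0.
have cvgw : {ae mu, forall x, D x -> cvgn (fun n => w_ n x)}.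
  (* Origin of the constant: with [t = 2^-n], integrating [g^2 / (2 t) + t / 2], where [g^2] has
     integral at most [8 t^2], gives at most [t / 2 * (8 + M)]. *)
  apply: (ae_cvg_of_summable_L1 mu D w_ (8 + M)) => // [|n]; first by rewrite addr_ge0.
  set g := fun x => w_ n.+1 x - w_ n x.
  have mg : measurable_fun D g by exact: measurable_funB.
  have gC x : D x -> `|g x| <= eps + eps.
    by move=> Dx; rewrite (le_trans (ler_normB _ _))// lerD// (bK _ _ (hw _).1).
  have ig : mu.-integrable D (EFin \o g) by exact: integrable_le_normr gC.
  have ig2 : mu.-integrable D (EFin \o (fun x => g x ^+ 2)).
    exact: (integrable_sqr mu D g (eps + eps)).
  have ic (c : R) : mu.-integrable D (EFin \o (fun=> c)).
    by apply: (integrable_le_normr _ _ _ `|c|).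
  have ian : mu.-integrable D (EFin \o (fun x => `|g x|)).
    apply: (integrable_le_normr _ _ _ (eps + eps)) => //.
      exact: measurableT_comp.
    by move=> x Dx; rewrite normr_id gC.
  have -> : (\int[mu]_(x in D) `|g x|%:E)%E = (\int[mu]_(x in D) `|g x|)%:E.
    by rewrite /Rintegral fineK//; exact: integrable_fin_num.
  pose t : R := 2^-1 ^+ n.
  have t0 : 0 < t by rewrite exprn_gt0.
  have -> : (8 + M) / (2 ^ n.+1)%:R = t / 2 * (8 + M).
    by rewrite natrX exprS invfM /t exprVn; ring.
  rewrite lee_fin.
  (* AM-GM: [2 |g| <= g^2 / t + t] *)
  have le1 : \int[mu]_(x in D) `|g x| <=
      \int[mu]_(x in D) ((2 * t)^-1 * g x ^+ 2 + t / 2).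
    apply: le_Rintegral => //; first by apply: integrable_add => //; exact: integrable_scale.
    move=> x _; rewrite -subr_ge0 -[g x ^+ 2]real_normK ?num_real//.
    have -> : (2 * t)^-1 * `|g x| ^+ 2 + t / 2 - `|g x| =
        (2 * t)^-1 * (`|g x| - t) ^+ 2 by field; rewrite gt_eqF.
    by rewrite mulr_ge0 ?sqr_ge0// invr_ge0 mulr_ge0// ltW.
  rewrite (le_trans le1)// RintegralD//; last exact: integrable_scale.
  rewrite Rintegral_cst// RintegralZl// mulrDr lerD//.
  have -> : t / 2 * 8 = (2 * t)^-1 * (8 * e_ n).
    by rewrite /e_ -/t; field; rewrite gt_eqF.
  rewrite ler_wpM2l//; first by rewrite invr_ge0 mulr_ge0// ltW.
  exact: (hw n).2.
(* The upper limit is defined and measurable on all of [D], with [fine] giving 0 where it is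
   infinite. It agrees with the limit wherever the sequence converges. *)
exists w_, (fun x => fine (limn_esup (fun n => (w_ n x)%:E))); split.
- by move=> n; exact: (hw n).1.
- apply: measurableT_comp; first exact: fine_measurable.
  by apply: measurable_fun_limn_esup => n; exact/measurable_EFinP.
- apply: filterS cvgw => x /[apply] /cvg_ex[l wl].
  rewrite (_ : fine _ = l)//.
  have /cvg_limn_einf_sup[_ ->//] : (fun n => (w_ n x)%:E) @ \oo --> l%:E.
  by apply/fine_cvgP; split; [exact: nearW|exact: wl].
Qed.

(** * Passage to the limit in integrals against bounded functions *)

Lemma integrable_mul_bounded {d} {T : measurableType d} {R : realType}
    (mu : {measure set T -> \bar R}) (D : set T) (f g : T -> R) (C : R) :
  measurable D -> mu.-integrable D (EFin \o f) -> measurable_fun D g ->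
  (forall x, D x -> `|g x| <= C) ->
  mu.-integrable D (EFin \o (fun x => f x * g x)).
Proof.
move=> mD fi mg gC; have mf : measurable_fun D f.
  by apply/measurable_EFinP; exact: measurable_int fi.
apply: (@le_integrable _ _ _ _ _ mD _ (EFin \o (fun x => C * `|f x|))).
- by apply/measurable_EFinP; exact: measurable_funM.
- move=> x Dx; rewrite /= lee_fin normrM mulrC.
  rewrite [leRHS]ger0_norm ?mulr_ge0//; first exact: ler_wpM2r (gC x Dx).
  exact: le_trans (gC x Dx).
- by apply: integrable_scale => //; exact: integrable_norm.
Qed.

Lemma dominated_ae_cvg_L1 {d} {T : measurableType d} {R : realType}
    (mu : {measure set T -> \bar R}) (D : set T) (eps : R)
    (w_ : nat -> T -> R) (w : T -> R) :
  measurable D -> (mu D < +oo)%E ->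
  (forall n, measurable_fun D (w_ n)) -> measurable_fun D w ->
  (forall n x, D x -> `|w_ n x| <= eps) ->
  {ae mu, forall x, D x -> w_ ^~ x @ \oo --> w x} ->
  mu.-integrable D (EFin \o w) /\
  (fun n => \int[mu]_(x in D) `|w_ n x - w x|) @ \oo --> (0 : R).
Proof.
move=> mD Doo mw_ mw wb ww.
have mE (f : T -> R) : measurable_fun D f -> measurable_fun D (EFin \o f).
  by move=> mf; exact/measurable_EFinP.
have ie : mu.-integrable D (EFin \o cst eps).
  by apply: (integrable_le_normr mu D (cst eps) `|eps|).
have [||iw + _] := dominated_convergence mD (fun n => mE _ (mw_ n)) (mE _ mw) _ ie _.
- by apply: filterS ww => x /[apply] h; apply/fine_cvgP; split; [exact: nearW|exact: h].
- by apply: nearW => x n Dx; rewrite /= lee_fin wb.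
move=> /fine_cvgP[_ h]; split => //.
Qed.

(** [Phi] stands for the divergences of the test fields. The bound by [L] concerns linear
    functionals with bounded densities, so it survives both midpoints and L^1 limits. Only the
    perturbations [w] need the compactness substitute, since the functions [u'] are already close to
    [u]. *)
Lemma bounded_perturbation_limit {d} {T : measurableType d} {R : realType}
    (mu : {measure set T -> \bar R}) (D : set T) (eps L : R)
    (Phi : set (T -> R)) (u : T -> R) :
  measurable D -> (mu D < +oo)%E -> mu.-integrable D (EFin \o u) ->
  (forall g, Phi g -> measurable_fun D g) ->
  (forall g, Phi g -> exists C, forall x, D x -> `|g x| <= C) ->
  (forall e, 0 < e -> exists w u' : T -> R, [/\ measurable_fun D w,
    forall x, D x -> `|w x| <= eps, mu.-integrable D (EFin \o u'),
    \int[mu]_(x in D) `|u' x - u x| <= e &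
    forall g, Phi g -> \int[mu]_(x in D) ((u' x + w x) * g x) <= L + e]) ->
  exists w : T -> R, [/\ measurable_fun D w, mu.-integrable D (EFin \o w),
    {ae mu, forall x, D x -> `|w x| <= eps} &
    forall g, Phi g -> \int[mu]_(x in D) ((u x + w x) * g x) <= L].
Proof.
move=> mD Doo iu mPhi bPhi happrox.
pose K n := [set w : T -> R | exists u' : T -> R, [/\ measurable_fun D w,
    forall x, D x -> `|w x| <= eps, mu.-integrable D (EFin \o u'),
    \int[mu]_(x in D) `|u' x - u x| <= n.+1%:R^-1 &
    forall g, Phi g -> \int[mu]_(x in D) ((u' x + w x) * g x) <= L + n.+1%:R^-1]].
have isub (f g : T -> R) : mu.-integrable D (EFin \o f) -> mu.-integrable D (EFin \o g) ->
    mu.-integrable D (EFin \o (fun x => f x - g x)).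
  by move=> /(integrableB mD) /[apply]; exact: eq_integrable.
have iabs (f : T -> R) : mu.-integrable D (EFin \o f) ->
    mu.-integrable D (EFin \o (fun x => `|f x|)) by exact: integrable_norm.
have iw (w : T -> R) : measurable_fun D w -> (forall x, D x -> `|w x| <= eps) ->
    mu.-integrable D (EFin \o w) by move=> mw; exact: integrable_le_normr.
have imul (f g : T -> R) : mu.-integrable D (EFin \o f) -> Phi g ->
    mu.-integrable D (EFin \o (fun x => f x * g x)).
  move=> fi Pg; have [C gC] := bPhi _ Pg.
  by apply: integrable_mul_bounded gC => //; exact: mPhi.
have mid n f g : K n f -> K n g -> K n (fun x => (f x + g x) / 2).
  move=> [u1 [mf bf iu1 d1 h1]] [u2 [mg bg iu2 d2 h2]].
  (* The average of the two witnesses serves the midpoint: the triangle inequality controls its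
     distance to [u], and linearity the integrals against [Phi]. *)
  exists (fun x => 2^-1 * (u1 x + u2 x)); split.
  - by apply: measurable_funM => //; exact: measurable_funD.
  - move=> x Dx; rewrite normrM normfV [X in _ / X]ger0_norm//.
    have := bf x Dx; have := bg x Dx; have := ler_normD (f x) (g x); lra.
  - by apply: integrable_scale => //; exact: integrable_add.
  - rewrite (@le_trans _ _ (\int[mu]_(x in D)
        (2^-1 * (`|u1 x - u x| + `|u2 x - u x|))))//.
      apply: le_Rintegral => //.
      + apply: iabs; apply: isub => //.
        by apply: integrable_scale => //; exact: integrable_add.
      + apply: integrable_scale => //.
        by apply: integrable_add => //; apply: iabs; exact: isub.
      + move=> x _.
        have -> : 2^-1 * (u1 x + u2 x) - u x = 2^-1 * ((u1 x - u x) + (u2 x - u x)).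
          by field.
        by rewrite normrM ger0_norm// ler_wpM2l// ler_normD.
    rewrite RintegralZl//; last first.
      by apply: integrable_add => //; apply: iabs; exact: isub.
    rewrite RintegralD//; [|by apply: iabs; exact: isub..].
    by move: d1 d2; set c := _^-1; lra.
  - move=> k Pk.
    have -> : \int[mu]_(x in D) ((2^-1 * (u1 x + u2 x) + (f x + g x) / 2) * k x) =
      \int[mu]_(x in D) (2^-1 * ((u1 x + f x) * k x + (u2 x + g x) * k x)).
      by apply: eq_Rintegral => x _; field.
    have i1 : mu.-integrable D (EFin \o (fun x => (u1 x + f x) * k x)).
      by apply: (imul (fun x => u1 x + f x)) => //; apply: integrable_add => //; exact: iw.
    have i2 : mu.-integrable D (EFin \o (fun x => (u2 x + g x) * k x)).
      by apply: (imul (fun x => u2 x + g x)) => //; apply: integrable_add => //; exact: iw.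
    rewrite RintegralZl//; last exact: integrable_add.
    rewrite RintegralD//.
    by move: (h1 _ Pk) (h2 _ Pk); set c := _^-1; lra.
have [w_ [w [Kw_ mw ww]]] : exists (w_ : nat -> T -> R) (w : T -> R),
    [/\ forall n, K n (w_ n), measurable_fun D w &
      {ae mu, forall x, D x -> w_ ^~ x @ \oo --> w x}].
  apply: (exists_ae_limit mu D eps K) => //.
  - move=> m n mn f [u' [mf bf iu' ud h]]; exists u'.
    have le : n.+1%:R^-1 <= m.+1%:R^-1 :> R by rewrite lef_pV2 ?posrE// ler_nat.
    split => //; first exact: le_trans le.
    by move=> g Pg; rewrite (le_trans (h g Pg))// lerD2l.
  - move=> n; have [|f [u' h]] := happrox n.+1%:R^-1; first by rewrite invr_gt0.
    by exists f, u'.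
  - by move=> n f [u' []].
  - by move=> n f [u' []].
have mw_ n : measurable_fun D (w_ n) by have [u' []] := Kw_ n.
have bw_ n x : D x -> `|w_ n x| <= eps by have [u' [_ h _ _ _]] := Kw_ n; exact: h.
have [iww cw] := dominated_ae_cvg_L1 mu D eps w_ w mD Doo mw_ mw bw_ ww.
exists w; split => //.
  apply: filterS ww => x cx Dx.
  apply: (cvgr_to_le (cvg_norm (cx Dx))).
  by apply: nearW => n; exact: bw_.
move=> g Pg; have [C0 gC0] := bPhi _ Pg.
(* [C0] may be negative when [D] is empty; the estimates below multiply by a nonnegative bound. *)
pose C := `|C0|; have gC x : D x -> `|g x| <= C.
  by move=> Dx; rewrite (le_trans (gC0 x Dx))// ler_norm.
have C0' : 0 <= C by exact: normr_ge0.
have test (f : T -> R) : mu.-integrable D (EFin \o f) ->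
    \int[mu]_(x in D) (f x * g x) <= C * \int[mu]_(x in D) `|f x|.
  move=> fi; rewrite -RintegralZl//; last exact: iabs.
  apply: le_Rintegral => //; first exact: imul.
    by apply: integrable_scale => //; exact: iabs.
  move=> x Dx; rewrite (le_trans (ler_norm _))// normrM mulrC.
  by rewrite ler_wpM2r// gC.
have bound n : \int[mu]_(x in D) ((u x + w x) * g x) <=
    L + (1 + C) * n.+1%:R^-1 + C * \int[mu]_(x in D) `|w_ n x - w x|.
  have [u' [mwn bwn iu' ud h]] := Kw_ n.
  have iwn := iw _ mwn bwn.
  (* Split [u + w] as [(u' + w_ n) + (u - u') + (w - w_ n)]. The three integrals are at most
     [L + 1 / (n + 1)], [C / (n + 1)] and [C] times the L^1 distance of [w_ n] to [w]. *)
  have -> : \int[mu]_(x in D) ((u x + w x) * g x) =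
      \int[mu]_(x in D) ((u' x + w_ n x) * g x) +
      (\int[mu]_(x in D) ((u x - u' x) * g x) +
       \int[mu]_(x in D) ((w x - w_ n x) * g x)).
    rewrite -RintegralD//; [|exact: imul (isub _ _ _ _) _..].
    rewrite -RintegralD//; first by apply: eq_Rintegral => x _ /=; ring.
      by apply: (imul (fun x => u' x + w_ n x)) => //; exact: integrable_add.
    by apply: integrable_add => //; exact: imul (isub _ _ _ _) _.
  have h1 := h _ Pg.
  have h2 := test _ (isub _ _ iu iu').
  have h3 := test _ (isub _ _ iww iwn).
  have e1 : \int[mu]_(x in D) `|u x - u' x| = \int[mu]_(x in D) `|u' x - u x|.
    by apply: eq_Rintegral => x _; rewrite distrC.
  have e2 : \int[mu]_(x in D) `|w x - w_ n x| = \int[mu]_(x in D) `|w_ n x - w x|.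
    by apply: eq_Rintegral => x _; rewrite distrC.
  rewrite e1 in h2; rewrite e2 in h3.
  have h4 : C * \int[mu]_(x in D) `|u' x - u x| <= C * n.+1%:R^-1 by rewrite ler_wpM2l.
  by move: h1 h2 h3 h4; set c := _^-1; lra.
have lim : (fun n => L + (1 + C) * n.+1%:R^-1 +
    C * \int[mu]_(x in D) `|w_ n x - w x|) @ \oo --> L.
  have -> : L = L + (1 + C) * 0 + C * 0 by rewrite !mulr0 !addr0.
  apply: cvgD; last by apply: cvgM => //; exact: cvg_cst.
  apply: cvgD; first by rewrite !mulr0 !addr0; exact: cvg_cst.
  by apply: cvgM; [exact: cvg_cst|exact: cvg_harmonic].
by apply: (cvgr_to_ge lim); exact: nearW.
Qed.

(** * Boxes, and continuous functions on bounded sets *)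

Definition rV_box {R : realType} (n : nat) (M : R) : set 'rV[R]_n :=
  [set v | forall i, `[- M, M]%classic (v ord0 i)].

Lemma bounded_set_sub_box {R : realType} {n : nat} (A : set 'rV[R]_n) :
  bounded_set A -> exists M, A `<=` rV_box n M.
Proof.
move=> [M [_ AM]]; exists (M + 1) => v Av i.
have vM : `|v| <= M + 1 by apply: AM => //; rewrite ltrDl.
rewrite /= in_itv/= -ler_norml (le_trans _ vM)//.
by rewrite [leRHS]/Num.norm/= mx_normrE; apply/bigmax_geP; right; exists (ord0, i).
Qed.

Lemma compact_rV_box {R : realType} (n : nat) (M : R) : compact (rV_box n M).
Proof.
apply: (@rV_compact _ _ (fun=> `[- M, M]%classic)) => i.
exact: segment_compact.
Qed.

Lemma measurable_rV_box {R : realType} (n : nat) (M : R) :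
  measurable (rV_box n M).
Proof.
rewrite -[rV_box n M]setCK; apply: measurableC; apply: measurable_open_rV.
apply: closed_openC; apply: compact_closed; last exact: compact_rV_box.
exact: norm_hausdorff.
Qed.

(** Induction along the construction of [leb]: pulled back by [rV_cons], a box is the product of a
    segment and a box of one dimension less, both of finite measure. In dimension 0 the measure is a
    Dirac mass. *)
Lemma leb_rV_box_lty {R : realType} (n : nat) (M : R) :
  (leb n (rV_box n M) < +oo)%E.
Proof.
elim: n => [|n IH] /=; first by rewrite diracE ltry.
rewrite /lebesgue_rV_step /pushforward.
rewrite (_ : _ @^-1` _ = `[- M, M]%classic `*` rV_box n M); last first.
  apply/seteqP; split => [[x v] /= h|[x v] /= [hx hv] i].
    split; first by have := h ord0; rewrite mxE unlift_none.
    by move=> j; have := h (lift ord0 j); rewrite mxE liftK.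
  by rewrite mxE; case: unliftP => [j _|_] /=; [exact: hv|exact: hx].
rewrite product_measure1E//; last exact: measurable_rV_box.
rewrite lte_mul_pinfty//.
have : (@lebesgue_measure R `[(- M)%R, M]%classic < +oo)%E.
  by rewrite lebesgue_measure_itv/=; case: ifPn; rewrite -?EFinB ltry.
by rewrite ge0_fin_numE.
Qed.

Lemma continuous_measurable_fun_rV {R : realType} {n : nat} (f : 'rV[R]_n -> R) :
  continuous f -> measurable_fun setT f.
Proof.
move=> /continuousP cf; apply: (measurability _ (RGenOpens.measurableE R)).
move=> _ [_ [a [b ->] <-]]; rewrite setTI; apply: measurable_open_rV.
exact/cf/interval_open.
Qed.

Lemma continuous_divergence {R : realType} {N : nat} (D : set 'rV[R]_N)
    (phi : 'I_N -> 'rV[R]_N -> R) :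
  (forall i, C1c D (phi i)) -> continuous (divergence phi).
Proof.
move=> cphi; apply: continuous_big => [|i _]; first exact: add_continuous.
by have [[_ /(_ i)[_]]] := cphi i.
Qed.

(** Continuity on the whole space gives a bound on a compact box that contains [D]. *)
Lemma continuous_bounded_on_bounded {R : realType} {n : nat} (D : set 'rV[R]_n)
    (f : 'rV[R]_n -> R) :
  bounded_set D -> continuous f -> exists C, forall x, D x -> `|f x| <= C.
Proof.
move=> /bounded_set_sub_box[M DM] cf.
have /compact_bounded[C [_ hC]] : compact (f @` rV_box n M).
  apply: continuous_compact; last exact: compact_rV_box.
  exact: continuous_subspaceT.
exists (C + 1) => x /DM Dx; apply: hC; first by rewrite ltrDl.
by exists x.
Qed.

(** * Norms and variation through integrals and almost everywhere bounds *)

Section Lpnorm_facts.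
Context {R : realType} {N : nat}.
Implicit Types (D : set 'rV[R]_N) (u : 'rV[R]_N -> R).

Lemma Lpnorm1E D u :
  Lpnorm D 1%E u = (\int[leb N]_(x in D) `|u x|%:E)%E.
Proof.
rewrite /Lpnorm Lnorm1 [RHS]integral_mkcond; apply: eq_integral => x _.
by rewrite !patchE; case: ifPn => // _; rewrite abse0.
Qed.

Lemma inLp1P D u : measurable D ->
  inLp D 1%E u <-> (leb N).-integrable D (EFin \o u).
Proof.
move=> mD; rewrite /inLp Lpnorm1E; split => [[mu uoo]|/integrableP[mu uoo]].
  by apply/integrableP; split => //; exact/measurable_EFinP.
by split => //; exact/measurable_EFinP.
Qed.

Lemma Lpnorm_infP D u (e : R) : 0 <= e ->
  (Lpnorm D +oo%E u <= e%:E)%E <-> {ae leb N, forall x, D x -> `|u x| <= e}.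
Proof.
move=> e0; rewrite /Lpnorm unlock.
(* If the whole space is null, the L^oo norm is 0 by convention and every property holds almost
   everywhere. *)
case: ifPn => [_|]; last first.
  rewrite -leNgt => mu0; split => _; last by rewrite lee_fin.
  exists setT; split => //.
  by apply/eqP; rewrite eq_le mu0 measure_ge0.
split.
  move=> /ess_supP; apply: filterS => x /= h Dx.
  by move: h; rewrite patchE mem_set.
move=> h; apply/ess_supP; apply: filterS h => x /= h.
rewrite patchE; case: ifPn => [/set_mem/h//|_].
by rewrite abse0 lee_fin.
Qed.

End Lpnorm_facts.

(** Allows the lower limit to be approached by real levels [L] strictly above it, so that finite and
    infinite lower limits are treated together. *)
Lemma lee_EFin_dense {R : realType} (x y : \bar R) :
  (forall r : R, (y < r%:E)%E -> (x <= r%:E)%E) -> (x <= y)%E.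
Proof.
move: y => [r| |] h; last 2 first.
- by rewrite leey.
- move: x h => [a| |] h //; last by have := h 0 (ltNyr _).
  by have := h (a - 1) (ltNyr _); rewrite lee_fin lerBrDr gerDl ler10.
- by apply/lee_addgt0Pr => e e0; rewrite -EFinD h// lte_fin ltrDl.
Qed.

(** This set takes the place of [Phi] in [bounded_perturbation_limit]; [Var D v] is the supremum of
    the integrals of [v * g] over its members [g]. *)
Definition test_divergences {R : realType} {N : nat} (D : set 'rV[R]_N) :
    set ('rV[R]_N -> R) :=
  [set divergence phi | phi in [set phi : 'I_N -> 'rV[R]_N -> R |
    (forall i, C1c D (phi i)) /\
    (Lpnorm D +oo%E (fun x => Num.sqrt (\sum_(i < N) phi i x ^+ 2)) <= 1)%E]].

Lemma Var_leP {R : realType} {N : nat} (D : set 'rV[R]_N) (v : 'rV[R]_N -> R)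
    (L : R) :
  (Var D v <= L%:E)%E <-> forall g, test_divergences D g ->
    (\int[leb N]_(x in D) (v x * g x)%:E <= L%:E)%E.
Proof.
split => [vL _ [phi hphi <-]|h].
  by apply: le_trans vL; apply: ereal_sup_ubound; exists phi.
by apply: ge_ereal_sup => _ [phi hphi <-]; apply: h; exists phi.
Qed.

(** * Lower semicontinuity, from the limit argument applied to [test_divergences] *)

Theorem proposition3p19 (R : realType) (N : nat) (hN : (1 <= N)%N)
  (Omega : set 'rV[R]_N) (hBV : BV_extension_domain Omega)
  (hbounded : bounded_set Omega)
  (hinterval : N = 1%N ->
     forall i : 'I_N, is_interval [set x ord0 i | x in Omega])
  (u_ : nat -> 'rV[R]_N -> R) (u : 'rV[R]_N -> R)
  (hu_ : forall n, inf_regulated Omega (u_ n))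
  (hu : inLp Omega 1%E u)
  (hcvg : Lpnorm Omega 1%E (u_ n \- u) @[n --> \oo] --> 0%E)
  (eps : R) (heps : 0 < eps) :
  (eps_inf_Var Omega eps u <=
     limn_einf (fun n => eps_inf_Var Omega eps (u_ n)))%E.
Proof.
have [oO _ _] := hBV.
have mO : measurable Omega := measurable_open_rV oO.
have Ooo : (leb N Omega < +oo)%E.
  have [M OM] := bounded_set_sub_box _ hbounded.
  apply: le_lt_trans (leb_rV_box_lty N M).
  apply: le_measure; rewrite ?inE//; exact: measurable_rV_box.
have iu := (inLp1P _ _ mO).1 hu.
have iu_ n := (inLp1P _ _ mO).1 (hu_ n).1.
have mtest g : test_divergences Omega g -> measurable_fun Omega g.
  move=> [phi [cphi _] <-]; apply: measurable_funTS.
  exact: continuous_measurable_fun_rV (continuous_divergence _ _ cphi).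
have btest g : test_divergences Omega g ->
    exists C, forall x, Omega x -> `|g x| <= C.
  move=> [phi [cphi _] <-]; apply: continuous_bounded_on_bounded => //.
  exact: continuous_divergence cphi.
have imul (f g : 'rV[R]_N -> R) : (leb N).-integrable Omega (EFin \o f) ->
    test_divergences Omega g ->
    (leb N).-integrable Omega (EFin \o (fun x => f x * g x)).
  move=> fi tg; have [C gC] := btest _ tg.
  by apply: integrable_mul_bounded gC => //; exact: mtest.
have RintE (f : 'rV[R]_N -> R) : (leb N).-integrable Omega (EFin \o f) ->
    (\int[leb N]_(x in Omega) (f x)%:E)%E = (\int[leb N]_(x in Omega) f x)%:E.
  by move=> fi; rewrite /Rintegral fineK//; exact: integrable_fin_num.
apply: lee_EFin_dense => L infL.
have [w [mw iw wb hw]] : exists w : 'rV[R]_N -> R,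
    [/\ measurable_fun Omega w, (leb N).-integrable Omega (EFin \o w),
      {ae leb N, forall x, Omega x -> `|w x| <= eps} &
      forall g, test_divergences Omega g ->
        \int[leb N]_(x in Omega) ((u x + w x) * g x) <= L].
  apply: bounded_perturbation_limit => // e e0.
  have [n0 _ hn0] : \forall n \near \oo, (Lpnorm Omega 1%E (u_ n \- u)%R < e%:E)%E.
    have /fine_cvgP[fin cvg0] := hcvg.
    near=> n; rewrite -[Lpnorm _ _ _]fineK; last by near: n.
    by rewrite lte_fin; near: n; exact: cvgr_lt cvg0 _ e0.
  (* The lower limit is the supremum of the infima over tails, so the infimum over the indices from
     [n0] on is below [L]. This yields a late [n] and an admissible [v] for [u_ n] with variation
     below [L]. *)
  have : (einfs (fun n => eps_inf_Var Omega eps (u_ n)) n0 < L%:E)%E.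
    apply: le_lt_trans infL; rewrite limn_einf_lim.
    rewrite (cvg_lim _ (@cvg_einfs_sup R _))//.
    by apply: ereal_sup_ubound; exists n0.
  move=> /ereal_inf_lt[_ [n n0n <-]] /ereal_inf_lt[_ [v [vBV uv] <-]] vL.
  have iv := (inLp1P _ _ mO).1 vBV.1.
  have mu_ : measurable_fun Omega (u_ n) := (hu_ n).1.1.
  have mv : measurable_fun Omega v := vBV.1.1.
  (* The bound of [v - u_ n] by [eps] holds only almost everywhere. Truncation makes it hold at
     every point, as [bounded_perturbation_limit] demands. *)
  pose w x := Num.max (- eps) (Num.min eps (v x - u_ n x)).
  have mw : measurable_fun Omega w.
    apply: measurable_maxr => //; apply: measurable_minr => //.
    exact: measurable_funB.
  have wb x : `|w x| <= eps.
    rewrite ler_norml /w le_max lexx/= ge_max ge_min lexx/= andbT.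
    by rewrite (@le_trans _ _ 0)// ?oppr_le0 ltW.
  have iw : (leb N).-integrable Omega (EFin \o w).
    by apply: integrable_le_normr => // x _; exact: wb.
  exists w, (u_ n); split => //.
  - rewrite -lee_fin -RintE; first by rewrite -Lpnorm1E ltW// hn0.
    apply: (@integrable_norm _ _ _ _ Omega (fun x => u_ n x - u x)).
    by move: (iu_ n) iu => /(integrableB mO) /[apply]; exact: eq_integrable.
  - move=> g tg; rewrite -lee_fin -RintE; last first.
      by apply: (imul (fun x => u_ n x + w x)) => //; exact: integrable_add.
    rewrite (@le_trans _ _ L%:E)//; last by rewrite lee_fin lerDl ltW.
    (* The truncation is inactive almost everywhere, so [u_ n + w] may be replaced by [v] under the
       integral. *)
    rewrite (@ae_eq_integral _ _ _ _ _ (fun x => (v x * g x)%:E))//.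
    + by move: (ltW vL) => /Var_leP; exact.
    + apply/measurable_EFinP; apply: measurable_funM; last exact: mtest.
      exact: measurable_funD.
    + by apply/measurable_EFinP; apply: measurable_funM => //; exact: mtest.
    + move: uv => /(Lpnorm_infP _ _ _ (ltW heps)).
      apply: filterS => x /[apply] /=; rewrite ler_norml => /andP[uv1 uv2].
      congr ((_ * _)%:E); rewrite /w (min_idPr _); last lra.
      rewrite (max_idPr _); last lra.
      ring.
have iuw : (leb N).-integrable Omega (EFin \o (fun x => u x + w x)).
  exact: integrable_add.
have VL : (Var Omega (fun x => (u x + w x)%R) <= L%:E)%E.
  apply/Var_leP => g tg; rewrite RintE ?lee_fin; first exact: hw.
  exact: (imul (fun x => u x + w x)).
(* [u + w] competes in the infimum for [u]: its variation is at most [L], and [u - (u + w) = - w] is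
   bounded by [eps] almost everywhere. *)
apply: (le_trans _ VL); apply: ereal_inf_lbound.
exists (fun x => u x + w x) => //; split.
  split; first exact/inLp1P.
  exact: le_lt_trans VL (ltry _).
apply/Lpnorm_infP; first exact: ltW.
apply: filterS wb => x /[apply] /=.
by rewrite opprD addrA subrr sub0r normrN.
Unshelve. all: by end_near. Qed.
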